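(* Let $\rho$ be an $N$-qubit density matrix. Let $O_1,\dots,O_L$ be Hermitian $N$-qubit observables, where each $O_l$ is localized to a subset $\mathsf K_l\subseteq\{1,\dots,N\}$ with $|\mathsf K_l|\le K$, i.e. $O_l=O_{l,\mathsf K_l}\otimes\mathbb I_{\neg\mathsf K_l}$, and assume $\mathrm{tr}(O_{l,\mathsf K_l}^2)\ge (5/9)^{|\mathsf K_l|}$ for all $l$. Fix $\epsilon,\delta\in(0,1)$. Let $\hat\sigma_1,\dots,\hat\sigma_M$ be independent SIC POVM classical shadows of $\rho$ (each from an independent copy of $\rho$) with $$M\ge \tfrac{8}{3}\,3^K\max_{1\le l\le L}\mathrm{tr}(O_{l,\mathsf K_l}^2)\,\log(2L/\delta)/\epsilon^2 .$$ Then with probability at least $1-\delta$, $$\max_{1\le l\le L}\Big|\frac1M\sum_{m=1}^M\mathrm{tr}(O_l\hat\sigma_m)-\mathrm{tr}(O_l\rho)\Big|\le\epsilon .$$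
   Context: Let $|\psi_1\rangle,\dots,|\psi_4\rangle\in\mathbb C^2$ be unit vectors forming a single-qubit SIC set, i.e. $|\langle\psi_i|\psi_j\rangle|^2=1/3$ for all $i\neq j$; then $\{\tfrac12|\psi_i\rangle\langle\psi_i|\}_{i=1}^4$ is a POVM. Performing this measurement on each qubit of an $N$-qubit state $\rho$ yields an outcome string $(i_1,\dots,i_N)\in\{1,2,3,4\}^N$ with probability $\Pr[i_1\cdots i_N\mid\rho]=2^{-N}\langle\psi_{i_1}\otimes\cdots\otimes\psi_{i_N}|\,\rho\,|\psi_{i_1}\otimes\cdots\otimes\psi_{i_N}\rangle$. The SIC POVM classical shadow associated with this outcome is $\hat\sigma=\bigotimes_{n=1}^N\big(3|\psi_{i_n}\rangle\langle\psi_{i_n}|-\mathbb I\big)$. $\log$ is the natural logarithm. *)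

(* Defs.v *)
From HB Require Import structures.
From mathcomp Require Import all_boot all_order all_algebra.
From mathcomp Require Import complex.
From mathcomp Require Import reals exp.
Set Implicit Arguments. Unset Strict Implicit. Unset Printing Implicit Defensive.
Import Order.TTheory GRing.Theory Num.Theory.
Local Open Scope ring_scope.
Local Open Scope complex_scope.

Section QDefs.
Variable R : realType.
Local Notation C := R[i].

(* computational basis of the qubits of S ⊆ {0..N-1}: bit strings on S *)
Definition qubits (N : nat) (S : {set 'I_N}) : finType :=
  {ffun {i : 'I_N | i \in S} -> 'I_2}.
Definition qbasis (N : nat) : finType := {ffun 'I_N -> 'I_2}.

(* operators (matrices) on the Hilbert space spanned by a finite basis T *)
Definition op (T : finType) := T -> T -> C.

Definition trace (T : finType) (A : op T) : C := \sum_(x : T) A x x.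
Definition opmul (T : finType) (A B : op T) : op T :=
  fun x y => \sum_(z : T) A x z * B z y.
Definition is_hermitian (T : finType) (A : op T) : Prop :=
  forall x y, A y x = (A x y)^*.
Definition density (T : finType) (rho : op T) : Prop :=
  [/\ is_hermitian rho,
      (forall v : T -> C, 0 <= \sum_(x : T) \sum_(y : T) (v x)^* * rho x y * v y)
    & trace rho = 1].

Definition restr (N : nat) (S : {set 'I_N}) (x : qbasis N) : qubits S :=
  [ffun i => x (val i)].

(* O_S ⊗ I_{¬S} *)
Definition embed (N : nat) (S : {set 'I_N}) (A : op (qubits S)) : op (qbasis N) :=
  fun x y => if [forall i, (i \notin S) ==> (x i == y i)]
             then A (restr S x) (restr S y) else 0.

Definition inner2 (u v : 'I_2 -> C) : C := \sum_(a : 'I_2) (u a)^* * v a.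
Definition SIC (psi : 'I_4 -> 'I_2 -> C) : Prop :=
  (forall i, inner2 (psi i) (psi i) = 1) /\
  (forall i j, i != j -> `|inner2 (psi i) (psi j)| ^+ 2 = 3%:R^-1).

Definition prodvec (N : nat) (psi : 'I_4 -> 'I_2 -> C) (s : {ffun 'I_N -> 'I_4})
  (x : qbasis N) : C := \prod_(n < N) psi (s n) (x n).

Definition sic_prob (N : nat) (psi : 'I_4 -> 'I_2 -> C) (rho : op (qbasis N))
  (s : {ffun 'I_N -> 'I_4}) : R :=
  (2%:R ^- N) * @complex.Re R (\sum_(x : qbasis N) \sum_(y : qbasis N)
                     (prodvec psi s x)^* * rho x y * prodvec psi s y).

(* classical shadow  ⊗_n (3 |psi_{i_n}><psi_{i_n}| - I) *)
Definition shadow (N : nat) (psi : 'I_4 -> 'I_2 -> C) (s : {ffun 'I_N -> 'I_4}) :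
  op (qbasis N) :=
  fun x y => \prod_(n < N)
    (3%:R * psi (s n) (x n) * (psi (s n) (y n))^* - ((x n == y n)%:R)).

Definition prob_shadows (N M : nat) (psi : 'I_4 -> 'I_2 -> C) (rho : op (qbasis N))
  (E : pred {ffun 'I_M -> {ffun 'I_N -> 'I_4}}) : R :=
  \sum_(w | E w) \prod_(m < M) sic_prob psi rho (w m).

(* tr(A^2) as a real number (A Hermitian, so the trace is real) *)
Definition trsq (T : finType) (A : op T) : R := @complex.Re R (trace (opmul A A)).

End QDefs.

(* Main.v *)
(** Discarding the qubits outside the support of [O] (each one-qubit shadow has
    trace 1), the estimator is X = tr(O_S sigma_S).  A SIC is a 2-design, which
    gives unbiasedness and, together with the marginal bound Pr <= 2^-|S|,
    E X^2 <= 3^|S| tr(O_S^2).  Cauchy-Schwarz gives X^2 <= 5^|S| tr(O_S^2), and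
    the hypothesis tr(O_S^2) >= (5/9)^|S| turns this into |X| <= 3^|S| tr(O_S^2).
    So a single number v bounds both |X| and E X^2, and Bernstein's argument with
    exponent parameter 3 eps / (4 v), where e^u <= 1 + u + (2/3) u^2 for
    |u| <= 3/4, yields the tail exp(- (3/8) M eps^2 / v); conclude by a union
    bound over the L observables and the two signs. *)
Require Import Defs.
From HB Require Import structures.
From mathcomp Require Import all_boot all_order all_algebra.
From mathcomp Require Import complex.
From mathcomp Require Import reals exp.
From mathcomp Require Import sequences normedtype topology.
From mathcomp Require Import ring lra.
Set Implicit Arguments.
Unset Strict Implicit.
Unset Printing Implicit Defensive.
Import Order.TTheory GRing.Theory Num.Theory.
Local Open Scope complex_scope.
Local Open Scope ring_scope.

(** * Exponential estimate, Bernstein tail and union bound *)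

(** Each further Taylor term gains a factor |x|/(n+3) <= (3/4)/3 = 1/4. *)
Lemma exp_coeff_le_geometric (R : realType) (x : R) (n : nat) :
  `|x| <= 3 / 4 -> exp_coeff x n.+2 <= x ^+ 2 / 2 * 4^-1 ^+ n.
Proof.
move=> hx; apply: le_trans (ler_norm _) _.
rewrite /exp_coeff /= normrM normrX normfV normr_nat.
rewrite -[x ^+ 2]ger0_norm ?sqr_ge0 // normrX.
elim: n => [|n IHn]; first by rewrite expr0 mulr1.
rewrite factS natrM invfM exprS [4^-1 ^+ _]exprS.
have -> : `|x| * `|x| ^+ n.+2 * (n.+3%:R^-1 * n.+2`!%:R^-1)
  = (`|x| / n.+3%:R) * (`|x| ^+ n.+2 / n.+2`!%:R) by ring.
rewrite [leRHS]mulrCA.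
apply: ler_pM => //; first by apply: divr_ge0; rewrite ?ler0n.
  by apply: divr_ge0; rewrite ?ler0n ?exprn_ge0.
rewrite ler_pdivrMr ?ltr0n // (le_trans hx) //.
have : (3 : R) <= n.+3%:R by rewrite ler_nat.
lra.
Qed.

(** The geometric tail (x^2/2)(1 + 1/4 + 1/16 + ...) sums to (2/3) x^2. *)
Lemma expR_le_quadratic (R : realType) (x : R) :
  `|x| <= 3 / 4 -> expR x <= 1 + x + 2 / 3 * x ^+ 2.
Proof.
move=> hx; rewrite /expR; apply: limr_le; first exact: is_cvg_series_exp_coeff.
exists 2%N => // n /= hn.
have -> : n = (n - 2).+2 by rewrite -addn2 subnK.
(* The exact geometric partial sum is kept, so that the induction closes. *)
have : series (exp_coeff x) (n - 2).+2
    <= 1 + x + 2 / 3 * x ^+ 2 * (1 - 4^-1 ^+ (n - 2)).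
  elim: (n - 2)%N => [|k IHk].
    rewrite /series /= big_nat_recr //= big_nat1 /exp_coeff /=.
    by rewrite !expr0 !expr1 !divr1 subrr mulr0 addr0.
  rewrite /series /= big_nat_recr //= -/(series _ _).
  have := exp_coeff_le_geometric k hx.
  move=> h; rewrite [4^-1 ^+ k.+1]exprS.
  apply: le_trans (lerD IHk h) _.
  lra.
move=> h; apply: le_trans h _.
rewrite lerD2l mulrBr mulr1 gerBl; apply: mulr_ge0; last first.
  by rewrite exprn_ge0 // invr_ge0.
by apply: mulr_ge0; [lra | exact: sqr_ge0].
Qed.

Lemma chernoff_bound (R : realType) (Om : finType) (M : nat) (p X : Om -> R)
    (v eps : R) :
  (forall o, 0 <= p o) -> \sum_o p o = 1 -> 0 < v -> 0 < eps < 1 ->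
  (forall o, `|X o| <= v) -> \sum_o p o * X o ^+ 2 <= v ->
  \sum_(w : {ffun 'I_M -> Om} |
        M%:R * (\sum_o p o * X o + eps) <= \sum_(m < M) X (w m))
     \prod_(m < M) p (w m) <= expR (- (3 / 8 * eps ^+ 2 / v * M%:R)).
Proof.
move=> p0 p1 v0 /andP[e0 e1] hX hX2; set mu := \sum_o p o * X o.
(* This is the minimizer of - la eps + (2/3) la^2 v, with minimum - (3/8) eps^2 / v. Since eps < 1,
   it also keeps |la X| <= la v <= 3/4. *)
pose la := 3 / 4 * (eps / v).
have la0 : 0 < la by rewrite mulr_gt0 // ?divr_gt0.
have lav : la * v = 3 / 4 * eps by rewrite /la; field; rewrite gt_eqF.
(* Exponential Markov inequality: the weight is at least 1 on the event and nonnegative off it. *)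
apply: (@le_trans _ _ (\sum_(w : {ffun 'I_M -> Om})
   \prod_(m < M) (p (w m) * expR (la * (X (w m) - (mu + eps)))))).
  rewrite [leRHS](bigID (fun w : {ffun 'I_M -> Om} =>
    M%:R * (mu + eps) <= \sum_(m < M) X (w m))) /=.
  rewrite ler_wpDr //.
    by apply: sumr_ge0 => w _; apply: prodr_ge0 => m _; rewrite mulr_ge0 ?expR_ge0.
  apply: ler_sum => w hw; rewrite big_split /= ler_peMr ?prodr_ge0 //.
  rewrite -expR_sum -expR0 ler_expR -mulr_sumr mulr_ge0 ?(ltW la0) //.
  by rewrite sumrB sumr_const card_ord -mulr_natl subr_ge0.
(* Independence: the sum over samples is the M-th power of a one-sample sum, so it suffices to bound
   the latter. *)
rewrite -(bigA_distr_bigA (fun m o => p o * expR (la * (X o - (mu + eps))))) /=.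
rewrite prodr_const card_ord -mulNr expRM_natr lerXn2r ?nnegrE ?expR_ge0 //.
  by apply: sumr_ge0 => o _; rewrite mulr_ge0 ?expR_ge0.
have -> : \sum_o p o * expR (la * (X o - (mu + eps)))
   = expR (- (la * (mu + eps))) * \sum_o p o * expR (la * X o).
  rewrite mulr_sumr; apply: eq_bigr => o _.
  by rewrite mulrBr expRD; ring.
have hE : \sum_o p o * expR (la * X o) <= expR (la * mu + 2 / 3 * la ^+ 2 * v).
  (* The quadratic bound is averaged for the uncentred X, and 1 + u <= e^u restores an exponential;
     the mean cancels only at the end. *)
  apply: le_trans (expR_ge1Dx _).
  apply: (@le_trans _ _ (\sum_o (p o + la * (p o * X o)
     + 2 / 3 * la ^+ 2 * (p o * X o ^+ 2)))).
    apply: ler_sum => o _.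
    have -> : p o + la * (p o * X o) + 2 / 3 * la ^+ 2 * (p o * X o ^+ 2)
      = p o * (1 + la * X o + 2 / 3 * (la * X o) ^+ 2) by ring.
    apply: ler_wpM2l => //; apply: expR_le_quadratic.
    rewrite normrM gtr0_norm //.
    by have := ler_wpM2l (ltW la0) (hX o); rewrite lav; lra.
  rewrite !big_split /= -!mulr_sumr p1 -/mu addrA lerD2l.
  by apply: ler_wpM2l => //; apply: mulr_ge0; [lra | exact: sqr_ge0].
apply: le_trans (ler_wpM2l (expR_ge0 _) hE) _.
rewrite -expRD ler_expR le_eqVlt; apply/orP; left; apply/eqP.
by rewrite /la; field; rewrite gt_eqF.
Qed.

Lemma uniform_concentration (R : realType) (Om : finType) (L M : nat)
    (p : Om -> R) (X : 'I_L -> Om -> R) (v eps delta : R) :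
  (forall o, 0 <= p o) -> \sum_o p o = 1 -> (0 < L)%N -> 0 < v ->
  0 < eps < 1 -> 0 < delta < 1 ->
  (forall l o, `|X l o| <= v) -> (forall l, \sum_o p o * X l o ^+ 2 <= v) ->
  8 / 3 * v * ln (2 * L%:R / delta) / eps ^+ 2 <= M%:R ->
  1 - delta <= \sum_(w : {ffun 'I_M -> Om} |
      [forall l, `|M%:R^-1 * \sum_(m < M) X l (w m) - \sum_o p o * X l o| <= eps])
    \prod_(m < M) p (w m).
Proof.
move=> p0 p1 L0 v0 he /andP[d0 d1] hX hX2 hM.
have e0 : 0 < eps by case/andP: he.
have L1 : (1 : R) <= L%:R by rewrite ler1n.
(* The logarithm is therefore positive, which forces M > 0 and makes division by M legitimate. *)
have q1 : 1 < 2 * L%:R / delta by rewrite ltr_pdivlMr //; lra.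
have M0 : 0 < M%:R :> R.
  apply: lt_le_trans hM; rewrite divr_gt0 ?exprn_gt0 // mulr_gt0 ?ln_gt0 //.
  by apply: mulr_gt0 => //; lra.
have tail : 2 * L%:R * expR (- (3 / 8 * eps ^+ 2 / v * M%:R)) <= delta.
  have hexp : expR (- (3 / 8 * eps ^+ 2 / v * M%:R)) <= delta / (2 * L%:R).
    rewrite -[leRHS]invrK invf_div -[_ / delta]lnK; last first.
      by rewrite posrE (lt_trans ltr01).
    rewrite -expRN ler_expR lerN2.
    move: hM; rewrite ler_pdivrMr ?exprn_gt0 // => hM.
    have -> : 3 / 8 * eps ^+ 2 / v * M%:R = 3 / 8 * (M%:R * eps ^+ 2) / v by ring.
    by rewrite ler_pdivlMr //; lra.
  rewrite mulrC; apply: le_trans (ler_wpM2r _ hexp) _; first by lra.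
  by rewrite divfK // gt_eqF //; lra.
pose P (w : {ffun 'I_M -> Om}) := \prod_(m < M) p (w m).
have P0 w : 0 <= P w by apply: prodr_ge0.
have P1 : \sum_w P w = 1.
  rewrite /P -(bigA_distr_bigA (fun _ : 'I_M => p)) /=.
  by rewrite prodr_const p1 expr1n.
pose mu l := \sum_o p o * X l o.
pose up l (w : {ffun 'I_M -> Om}) :=
  M%:R * (mu l + eps) <= \sum_(m < M) X l (w m).
(* The lower tail is the upper tail of - X, so one Chernoff bound serves both signs. *)
pose dn l (w : {ffun 'I_M -> Om}) :=
  M%:R * (- mu l + eps) <= \sum_(m < M) - X l (w m).
have hup l : \sum_(w | up l w) P w <= expR (- (3 / 8 * eps ^+ 2 / v * M%:R)).
  exact: chernoff_bound.
have hdn l : \sum_(w | dn l w) P w <= expR (- (3 / 8 * eps ^+ 2 / v * M%:R)).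
  rewrite /dn; have -> : - mu l = \sum_o p o * - X l o.
    by rewrite -sumrN; apply: eq_bigr => o _; rewrite mulrN.
  apply: (@chernoff_bound R Om M p (fun o => - X l o)) => //.
    by move=> o; rewrite normrN.
  by under eq_bigr do rewrite sqrrN.
rewrite lerBlDr -{1}P1 (bigID (fun w : {ffun 'I_M -> Om} => [forall l,
  `|M%:R^-1 * \sum_(m < M) X l (w m) - mu l| <= eps])) /= lerD2l.
apply: le_trans tail.
have -> : 2 * L%:R * expR (- (3 / 8 * eps ^+ 2 / v * M%:R))
  = \sum_(l < L) (expR (- (3 / 8 * eps ^+ 2 / v * M%:R))
                  + expR (- (3 / 8 * eps ^+ 2 / v * M%:R))).
  by rewrite sumr_const card_ord -mulr_natl; ring.
apply: le_trans (ler_sum _ (fun l _ => lerD (hup l) (hdn l))).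
rewrite big_mkcond /=.
rewrite (_ : \sum_(l < L) _ = \sum_(l < L) \sum_w
    ((if up l w then P w else 0) + (if dn l w then P w else 0))); last first.
  by apply: eq_bigr => l _; rewrite big_split /= -!big_mkcond.
(* The union bound is checked sample by sample: a bad w is charged to an index l where the deviation
   exceeds eps. *)
rewrite exchange_big /=; apply: ler_sum => w _.
have t0 l : 0 <= (if up l w then P w else 0) + (if dn l w then P w else 0).
  by apply: addr_ge0; case: ifP.
case: ifP => [|_]; last by apply: sumr_ge0.
move=> /forallPn[l]; rewrite -ltNge => hl.
rewrite (bigD1 l) //= ler_wpDr ?sumr_ge0 //.
have : up l w || dn l w.
  rewrite /up /dn sumrN.
  have -> : \sum_(m < M) X l (w m) = M%:R * (M%:R^-1 * \sum_(m < M) X l (w m)).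
    by rewrite mulVKf // gt_eqF.
  rewrite -mulrN !ler_pM2l //.
  move: hl; rewrite lter_normr => /orP[] h; apply/orP; [left|right]; lra.
case/orP => ->; first by rewrite ler_wpDr //; case: ifP.
by rewrite ler_wpDl //; case: ifP.
Qed.

(** * Conjugation, positive kernels and Cauchy-Schwarz *)

Lemma conjCM (C : numClosedFieldType) (x y : C) : (x * y)^* = x^* * y^*.
Proof. exact: rmorphM. Qed.

Lemma conjCB (C : numClosedFieldType) (x y : C) : (x - y)^* = x^* - y^*.
Proof. exact: rmorphB. Qed.

Lemma conjCV (C : numClosedFieldType) (x : C) : (x^-1)^* = (x^*)^-1.
Proof. exact: fmorphV. Qed.

Lemma conjC_sum (C : numClosedFieldType) (I : finType) (F : I -> C) :
  (\sum_i F i)^* = \sum_i (F i)^*.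
Proof. exact: rmorph_sum. Qed.

Lemma conjC_prod (C : numClosedFieldType) (I : finType) (F : I -> C) :
  (\prod_i F i)^* = \prod_i (F i)^*.
Proof. exact: rmorph_prod. Qed.

(** The positivity clause of [density], isolated because it is also applied to the rank-one kernel
    of a vectorized observable. *)
Definition positive_kernel (R : realType) (T : finType) (B : T -> T -> R[i]) :=
  forall v : T -> R[i], 0 <= \sum_x \sum_y (v x)^* * B x y * v y.

(** Expanding the product over choices f : I -> J leaves, for each f, the quadratic form of B at a
    product vector. *)
Lemma positive_kernel_gram_prod (R : realType) (I T J : finType)
    (B : {ffun I -> T} -> {ffun I -> T} -> R[i]) (v : I -> J -> T -> R[i]) :
  positive_kernel B ->
  0 <= \sum_(x : {ffun I -> T}) \sum_(y : {ffun I -> T})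
         B x y * \prod_i \sum_j (v i j (x i))^* * v i j (y i).
Proof.
move=> hB.
rewrite [leRHS](_ : _ = \sum_(f : {ffun I -> J}) \sum_(x : {ffun I -> T}) \sum_(y : {ffun I -> T})
   (\prod_i v i (f i) (x i))^* * B x y * \prod_i v i (f i) (y i)).
  by apply: sumr_ge0 => f _; apply: hB.
rewrite [RHS]exchange_big /=; apply: eq_bigr => x _.
rewrite [RHS]exchange_big /=; apply: eq_bigr => y _.
rewrite bigA_distr_bigA mulr_sumr /=; apply: eq_bigr => f _.
by rewrite big_split conjC_prod /=; ring.
Qed.

(* Expand the product of the factors q + (q' - q): every term is nonnegative, and the product of the q is one of them. *)
Lemma le_gram_prod (R : realType) (I T J : finType)
    (B : {ffun I -> T} -> {ffun I -> T} -> R[i])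
    (q q' : I -> T -> T -> R[i]) (v v' : I -> J -> T -> R[i]) :
  positive_kernel B ->
  (forall i x y, q i x y = \sum_j (v i j x)^* * v i j y) ->
  (forall i x y, q' i x y = q i x y + \sum_j (v' i j x)^* * v' i j y) ->
  \sum_(x : {ffun I -> T}) \sum_(y : {ffun I -> T}) B x y * \prod_i q i (x i) (y i) <=
  \sum_(x : {ffun I -> T}) \sum_(y : {ffun I -> T}) B x y * \prod_i q' i (x i) (y i).
Proof.
move=> hB hq hq'.
pose V (f : {ffun I -> bool}) i := if f i then v i else v' i.
pose G f := \sum_(x : {ffun I -> T}) \sum_(y : {ffun I -> T}) B x y *
  \prod_i \sum_j (V f i j (x i))^* * V f i j (y i).
rewrite [leRHS](_ : _ = \sum_f G f).
  rewrite (bigD1 [ffun=> true]) //= [leLHS](_ : _ = G [ffun=> true]).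
    rewrite lerDl; apply: sumr_ge0 => f _.
    exact: positive_kernel_gram_prod.
  apply: eq_bigr => x _; apply: eq_bigr => y _; congr (_ * _).
  by apply: eq_bigr => i _; rewrite hq /V ffunE.
rewrite [RHS]exchange_big /=; apply: eq_bigr => x _.
rewrite [RHS]exchange_big /=; apply: eq_bigr => y _.
rewrite -mulr_sumr; congr (_ * _).
rewrite (eq_bigr (fun i => \sum_(b : bool)
    \sum_j ((if b then v i else v' i) j (x i))^* * (if b then v i else v' i) j (y i))).
  by rewrite bigA_distr_bigA.
by move=> i _; rewrite big_bool /= hq' hq.
Qed.

Lemma cauchy_schwarz_sum (R : realType) (T : finType) (f g : T -> R[i]) (G : R[i]) :
  0 < G -> \sum_x g x * (g x)^* = G ->
  (\sum_x f x * g x) * (\sum_x f x * g x)^* <= G * \sum_x f x * (f x)^*.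
Proof.
(* The coefficient c projects f on the conjugate of g; G times the squared norm of the residual is
   the gap of the inequality. *)
move=> G0 hG; set Y := \sum_x _; pose c := Y / G.
have GJ : G^* = G by rewrite conj_Creal ?gtr0_real.
have h : 0 <= \sum_x (f x - c * (g x)^*) * (f x - c * (g x)^*)^*.
  by apply: sumr_ge0 => x _; apply: mul_conjC_ge0.
rewrite -subr_ge0; have -> : G * \sum_x f x * (f x)^* - Y * Y^* =
  G * \sum_x (f x - c * (g x)^*) * (f x - c * (g x)^*)^*; last first.
  by rewrite mulr_ge0 // ltW.
rewrite [X in _ = _ * X](eq_bigr (fun x => f x * (f x)^* - c^* * (f x * g x) - c * (f x * g x)^*
   + c * c^* * (g x * (g x)^*))); last first.
  by move=> x _; rewrite !(conjCB, conjCM) conjCK; ring.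
rewrite big_split /= !sumrB -!mulr_sumr -/Y -conjC_sum -/Y hG /c conjCM conjCV GJ.
by field; rewrite gt_eqF.
Qed.

(** * The 2-design property of a SIC *)

Lemma sum4_eq0 (C : numClosedFieldType) (I : finType) (F : I -> I -> I -> I -> C) :
  \sum_x \sum_y \sum_u \sum_v F x y u v * (F x y u v)^* = 0 ->
  forall x y u v, F x y u v = 0.
Proof.
move=> h x y u v; apply/eqP; rewrite -mul_conjC_eq0; apply/eqP.
have p4 x' y' u' v' : 0 <= F x' y' u' v' * (F x' y' u' v')^* by apply: mul_conjC_ge0.
have p3 x' y' u' : 0 <= \sum_v' F x' y' u' v' * (F x' y' u' v')^* by apply: sumr_ge0.
have p2 x' y' : 0 <= \sum_u' \sum_v' F x' y' u' v' * (F x' y' u' v')^* by apply: sumr_ge0.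
have p1 x' : 0 <= \sum_y' \sum_u' \sum_v' F x' y' u' v' * (F x' y' u' v')^*.
  by apply: sumr_ge0.
have h1 : \sum_y \sum_u \sum_v F x y u v * (F x y u v)^* = 0 :=
  psumr_eq0P (fun i _ => p1 i) h isT.
have h2 : \sum_u \sum_v F x y u v * (F x y u v)^* = 0 :=
  psumr_eq0P (fun i _ => p2 x i) h1 isT.
have h3 : \sum_v F x y u v * (F x y u v)^* = 0 :=
  psumr_eq0P (fun i _ => p3 x y i) h2 isT.
exact: (psumr_eq0P (fun i _ => p4 x y u i) h3 isT).
Qed.

Lemma sum4_exchange (V : nmodType) (I J : finType) (F : J -> I -> I -> I -> I -> V) :
  \sum_x \sum_y \sum_u \sum_v \sum_j F j x y u v =
  \sum_j \sum_x \sum_y \sum_u \sum_v F j x y u v.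
Proof.
rewrite [RHS]exchange_big; apply: eq_bigr => x _.
rewrite [RHS]exchange_big; apply: eq_bigr => y _.
rewrite [RHS]exchange_big; apply: eq_bigr => u _.
by rewrite [RHS]exchange_big.
Qed.

(* The Hilbert-Schmidt norm of the difference of the two sides is 4 + 12/9 - 32/3 + 16/3 = 0. *)
Lemma SIC_2design (R : realType) (psi : 'I_4 -> 'I_2 -> R[i]) : SIC psi ->
  forall x y u v, \sum_i psi i x * (psi i y)^* * psi i u * (psi i v)^* =
    2 / 3 * ((x == y)%:R * (u == v)%:R + (x == v)%:R * (u == y)%:R).
Proof.
move=> [hn hs] x y u v.
pose w i x y u v : R[i] := psi i x * (psi i y)^* * psi i u * (psi i v)^*.
(* Here [w i] is the two-fold tensor power of the i-th projector, and [e] is (2/3)(identity + swap),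
   i.e. 4/3 times the projector onto the symmetric subspace. That subspace contains the range of
   each [w i], whence the overlap 4/3 in [we]. *)
pose e (x y u v : 'I_2) : R[i] :=
  2 / 3 * ((x == y)%:R * (u == v)%:R + (x == v)%:R * (u == y)%:R).
have sum2 (F : 'I_2 -> R[i]) : \sum_i F i = F ord0 + F ord_max.
  by rewrite 2!big_ord_recl big_ord0 addr0; congr (_ + F _); apply: val_inj.
have d01 : (ord0 == ord_max :> 'I_2) = false by [].
have d10 : (ord_max == ord0 :> 'I_2) = false by [].
have nn i : (psi i ord0)^* * psi i ord0 + (psi i ord_max)^* * psi i ord_max = 1.
  by rewrite -(hn i) /inner2 sum2.
have eC x' y' u' v' : (e x' y' u' v')^* = e x' y' u' v'.
  by rewrite /e -!natrM -!natrD !conjCM conjCV !conjC_nat.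
have c3 (c : R[i]) (i : 'I_4) : \sum_(j | j != i) c = 3 * c.
  by rewrite sumr_const cardC1 card_ord mulr_natl.
have c4 (c : R[i]) : \sum_(j < 4) c = 4 * c by rewrite sumr_const card_ord mulr_natl.
have ww i j : \sum_x \sum_y \sum_u \sum_v w i x y u v * (w j x y u v)^* =
   (`|inner2 (psi i) (psi j)| ^+ 2) ^+ 2.
  rewrite normCK /inner2 !sum2 /w !(conjCM, rmorphD) !conjCK /= !conjCM !conjCK; ring.
have we i : \sum_x \sum_y \sum_u \sum_v w i x y u v * e x y u v = 4 / 3.
  rewrite !sum2 /e !eqxx !d01 !d10 /= /w.
  transitivity (4 / 3 * ((psi i ord0)^* * psi i ord0 + (psi i ord_max)^* * psi i ord_max) ^+ 2).
    by field.
  by rewrite nn expr1n mulr1.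
have ee : \sum_x \sum_y \sum_u \sum_v e x y u v * e x y u v = 16 / 3.
  by rewrite !sum2 /e !eqxx !d01 !d10 /=; field.
suff z4 : \sum_x \sum_y \sum_u \sum_v (\sum_i w i x y u v - e x y u v) *
     (\sum_i w i x y u v - e x y u v)^* = 0.
  by apply: subr0_eq; apply: (sum4_eq0 z4 x y u v).
have -> : \sum_x \sum_y \sum_u \sum_v (\sum_i w i x y u v - e x y u v) *
     (\sum_i w i x y u v - e x y u v)^* =
  \sum_x \sum_y \sum_u \sum_v (\sum_i \sum_j w i x y u v * (w j x y u v)^*
    - \sum_i w i x y u v * e x y u v - \sum_i (w i x y u v * e x y u v)^*
    + e x y u v * e x y u v).
  apply: eq_bigr => x' _; apply: eq_bigr => y' _; apply: eq_bigr => u' _.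
  apply: eq_bigr => v' _; rewrite conjCB eC conjC_sum.
  have -> : \sum_i \sum_j w i x' y' u' v' * (w j x' y' u' v')^* =
      (\sum_i w i x' y' u' v') * \sum_j (w j x' y' u' v')^*.
    by rewrite mulr_suml; apply: eq_bigr => i _; rewrite mulr_sumr.
  have -> : \sum_i (w i x' y' u' v' * e x' y' u' v')^* =
      (\sum_i (w i x' y' u' v')^*) * e x' y' u' v'.
    by rewrite mulr_suml; apply: eq_bigr => i _; rewrite conjCM eC.
  by rewrite -mulr_suml; ring.
under eq_bigr do under eq_bigr do under eq_bigr do rewrite big_split !sumrB.
under eq_bigr do under eq_bigr do rewrite big_split !sumrB.
under eq_bigr do rewrite big_split !sumrB.
rewrite big_split !sumrB /= ee !sum4_exchange.
under [X in X - _ - _ + _]eq_bigr do rewrite sum4_exchange.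
under [X in X - _ - _ + _]eq_bigr => i _.
  under eq_bigr => j _ do rewrite ww.
  over.
rewrite (eq_bigr _ (fun i _ => we i)).
have -> : \sum_j \sum_x \sum_y \sum_u \sum_v (w j x y u v * e x y u v)^* = \sum_(j < 4) 4 / 3.
  apply: eq_bigr => j _; transitivity ((4 / 3 : R[i])^*).
    by rewrite -(we j); do 4![rewrite conjC_sum; apply: eq_bigr => ? _].
  by rewrite conjCM conjCV !conjC_nat.
(* Each row has one entry 1 and three entries (1/3)^2. *)
have -> : \sum_(i < 4) \sum_(j < 4) (`|inner2 (psi i) (psi j)| ^+ 2) ^+ 2 =
   \sum_(i < 4) (4 / 3 : R[i]).
  apply: eq_bigr => i _; rewrite (bigD1 i) //= hn normr1 !expr1n.
  rewrite (eq_bigr (fun=> 9^-1)); last first.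
    by move=> j ij; rewrite hs 1?eq_sym //; field.
  by rewrite c3; field.
by rewrite !c4; field.
Qed.

(** * Identities for one-qubit shadows *)

(** The one-site factor of [shadow]: the inverse of the SIC measurement channel applied to the
    observed projector. *)
Definition shadow1 (R : realType) (psi : 'I_4 -> 'I_2 -> R[i]) (i : 'I_4)
    (x y : 'I_2) : R[i] :=
  3 * psi i x * (psi i y)^* - (x == y)%:R.

Section OneQubit.
Variables (R : realType) (psi : 'I_4 -> 'I_2 -> R[i]).
Hypothesis psiP : SIC psi.

Let sum_delta (T : finType) (y : T) (F : T -> R[i]) :
  \sum_x (x == y)%:R * F x = F y.
Proof.
rewrite (bigD1 y) //= eqxx mul1r big1 ?addr0 // => x /negPf ->.
by rewrite mul0r.
Qed.

Lemma SIC_norm i : \sum_x psi i x * (psi i x)^* = 1.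
Proof. by rewrite -(psiP.1 i); apply: eq_bigr => x _; rewrite mulrC. Qed.

(** Partial trace of the 2-design identity over its second factor: (2/3)(2 + 1) = 2. *)
Lemma SIC_povm x y : \sum_i psi i x * (psi i y)^* = 2 * (x == y)%:R.
Proof.
transitivity (\sum_u \sum_i psi i x * (psi i y)^* * psi i u * (psi i u)^*).
  rewrite exchange_big; apply: eq_bigr => i _ /=.
  under eq_bigr do rewrite -mulrA.
  by rewrite -mulr_sumr SIC_norm mulr1.
rewrite (eq_bigr (fun u => 2 / 3 * ((x == y)%:R + (u == x)%:R * (u == y)%:R))); last first.
  by move=> u _; rewrite SIC_2design // eqxx mulr1 (eq_sym x u).
rewrite -mulr_sumr big_split /= sum_delta.
by rewrite sumr_const card_ord; field.
Qed.

Lemma conj_shadow1 i x y : (shadow1 psi i x y)^* = shadow1 psi i y x.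
Proof. by rewrite /shadow1 conjCB !conjCM conjCK !conjC_nat eq_sym; ring. Qed.

Lemma shadow1_trace i : \sum_x shadow1 psi i x x = 1.
Proof.
rewrite /shadow1 sumrB; under eq_bigr do rewrite -mulrA.
under [X in _ - X]eq_bigr do rewrite eqxx mulr1n.
by rewrite -mulr_sumr SIC_norm sumr_const card_ord; ring.
Qed.

(** Expanding, the 2-design term contributes 6 to both coefficients; the POVM and identity terms
    change the second one to 6 - 6 - 6 + 4 = -2. *)
Lemma shadow1_frame x y u v :
  \sum_i shadow1 psi i x y * shadow1 psi i u v =
  6 * ((x == v)%:R * (u == y)%:R) - 2 * ((x == y)%:R * (u == v)%:R).
Proof.
rewrite (eq_bigr (fun i => 9 * (psi i x * (psi i y)^* * psi i u * (psi i v)^*)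
  - 3 * (u == v)%:R * (psi i x * (psi i y)^*)
  - 3 * (x == y)%:R * (psi i u * (psi i v)^*) + (x == y)%:R * (u == v)%:R)).
  rewrite big_split /= !sumrB -!mulr_sumr SIC_2design // !SIC_povm.
  by rewrite sumr_const card_ord; field.
by move=> i _; rewrite /shadow1; ring.
Qed.

(** One-qubit unbiasedness, before the POVM weight 1/2: the subtracted identity cancels exactly the
    trace part of the 2-design sum. *)
Lemma shadow1_inversion x y u v :
  \sum_i (psi i x)^* * psi i y * shadow1 psi i u v =
  2 * ((u == x)%:R * (y == v)%:R).
Proof.
rewrite (eq_bigr (fun i => 3 * (psi i y * (psi i x)^* * psi i u * (psi i v)^*)
  - (u == v)%:R * (psi i y * (psi i x)^*))).
  by rewrite sumrB -!mulr_sumr SIC_2design // SIC_povm; field.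
by move=> i _; rewrite /shadow1; ring.
Qed.

(** A one-qubit shadow has eigenvalues 2 and -1, hence squared Hilbert-Schmidt norm 4 + 1. *)
Lemma shadow1_norm i :
  \sum_x \sum_y shadow1 psi i x y * (shadow1 psi i x y)^* = 5.
Proof.
rewrite (eq_bigr (fun x => \sum_y (9 * (psi i x * (psi i x)^*) * (psi i y * (psi i y)^*)
  + (y == x)%:R * (1 - 6 * (psi i x * (psi i y)^*))))).
  under eq_bigr do rewrite big_split /= sum_delta -mulr_sumr SIC_norm mulr1.
  rewrite big_split /= sumrB -!mulr_sumr SIC_norm sumr_const card_ord; ring.
move=> x _; apply: eq_bigr => y _; rewrite conj_shadow1 /shadow1.
by rewrite (eq_sym y); case: eqVneq => [->|_]; rewrite ?mulr1n ?mulr0n; ring.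
Qed.

(** Idempotence of a projector puts it in the Gram form required by [le_gram_prod]; the next lemma
    does this for the complement. *)
Lemma projector_gram i x y : (psi i x)^* * psi i y =
  \sum_(a < 2) ((psi i a)^* * psi i x)^* * ((psi i a)^* * psi i y).
Proof.
rewrite -[LHS]mul1r -(SIC_norm i) mulr_suml; apply: eq_bigr => a _.
by rewrite conjCM conjCK; ring.
Qed.

Lemma coprojector_gram i x y : (x == y)%:R - (psi i x)^* * psi i y =
  \sum_a ((a == x)%:R - (psi i a)^* * psi i x)^* *
         ((a == y)%:R - (psi i a)^* * psi i y).
Proof.
rewrite (eq_bigr (fun a => (a == x)%:R * (a == y)%:R
  - (a == x)%:R * ((psi i a)^* * psi i y) - (a == y)%:R * (psi i a * (psi i x)^*)
  + ((psi i a)^* * psi i x)^* * ((psi i a)^* * psi i y))).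
  by rewrite big_split /= !sumrB !sum_delta /= -projector_gram; ring.
by move=> a _; rewrite conjCB conjC_nat !conjCM conjCK; ring.
Qed.

End OneQubit.

(** * Outcome probabilities, marginals and unbiasedness on many qubits *)

(** Generic in the alphabet, to serve outcome strings as well as basis states; on the latter it is
    convertible to [restr]. *)
Definition ffun_restr (N : nat) (A : finType) (S : {set 'I_N}) (s : {ffun 'I_N -> A}) :
  {ffun {i : 'I_N | i \in S} -> A} := [ffun i => s (val i)].

(** Casing on [insub n] lets one product over all sites carry different factors inside and outside
    S. *)
Lemma prod_insub (C : comPzSemiRingType) (N : nat) (S : {set 'I_N})
    (a : {i : 'I_N | i \in S} -> C) (b : 'I_N -> C) :
  \prod_n (if insub n is Some i then a i else b n) =
  (\prod_i a i) * \prod_(n | n \notin S) b n.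
Proof.
rewrite (bigID (mem S)) /=; congr (_ * _); last first.
  by apply: eq_bigr => n nS; rewrite insubN.
rewrite (reindex_omap (val : {i | i \in S} -> 'I_N) insub) /=; last first.
  by move=> n nS; rewrite insubT.
rewrite [RHS](eq_bigl (fun i => (val i \in S) && (insub (val i) == Some i))).
  by apply: eq_bigr => i _; rewrite valK.
by move=> i; rewrite valK eqxx (valP i).
Qed.

(** The strings extending t form a family prescribed on S and free elsewhere, so the sum factorizes
    over sites. *)
Lemma sum_prod_ffun_restr (C : comPzSemiRingType) (N : nat) (A : finType)
    (S : {set 'I_N}) (t : {ffun {i : 'I_N | i \in S} -> A}) (F : 'I_N -> A -> C) :
  \sum_(s | ffun_restr S s == t) \prod_n F n (s n) =
  (\prod_i F (val i) (t i)) * \prod_(n | n \notin S) \sum_j F n j.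
Proof.
pose c (n : 'I_N) (j : A) : bool := if insub n is Some i then j == t i else true.
rewrite (eq_bigl (fun s => s \in family c)); last first.
  move=> s; apply/eqP/familyP => [h n|h].
    by rewrite /c /in_mem /=; case: insubP => //= i _ <-; rewrite -h ffunE.
  apply/ffunP => i; rewrite ffunE.
  by have := h (val i); rewrite /c /in_mem /= valK => /eqP.
rewrite -(bigA_distr_big_dep c F) /= -prod_insub; apply: eq_bigr => n _.
rewrite /c /in_mem /=; case: insubP => [i _ <-|_] //.
by rewrite big_pred1_eq.
Qed.

Lemma card_sub_ord (N : nat) (S : {set 'I_N}) : #|{: {i : 'I_N | i \in S}}| = #|S|.
Proof. by rewrite card_sig. Qed.

Section ManyQubits.
Variables (R : realType) (N : nat) (psi : 'I_4 -> 'I_2 -> R[i]).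
Variable rho : op R (qbasis N).
Hypothesis psiP : SIC psi.
Hypothesis rhoP : density rho.

Lemma prod_eqb (T : finType) (A : eqType) (x y : T -> A) :
  \prod_i (x i == y i)%:R = [forall i, x i == y i]%:R :> R[i].
Proof.
case: (boolP [forall i, x i == y i]) => [/forallP h|/forallPn[i /negPf h]].
  by rewrite big1 // => i _; rewrite h.
by rewrite (bigD1 i) //= h mul0r.
Qed.

Lemma prod_eq_ffun (T : finType) (A : eqType) (x y : {ffun T -> A}) :
  \prod_i (x i == y i)%:R = (x == y)%:R :> R[i].
Proof.
rewrite prod_eqb; congr (nat_of_bool _)%:R.
by apply/forallP/eqP => [h|-> //]; apply/ffunP => i; apply/eqP.
Qed.

Lemma sum_delta_ffun (T : finType) (y : T) (F : T -> R[i]) :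
  \sum_x F x * (x == y)%:R = F y.
Proof.
rewrite (bigD1 y) //= eqxx mulr1 big1 ?addr0 // => x /negPf ->.
by rewrite mulr0.
Qed.

Lemma sic_probE s : (sic_prob psi rho s)%:C%C =
  \sum_x \sum_y rho x y *
    \prod_n (2^-1 * ((psi (s n) (x n))^* * psi (s n) (y n))).
Proof.
have [_ pos _] := rhoP.
rewrite /sic_prob rmorphM /= RRe_real; last exact: ger0_real (pos _).
rewrite fmorphV rmorphXn rmorph_nat mulr_sumr; apply: eq_bigr => x _.
rewrite mulr_sumr; apply: eq_bigr => y _.
rewrite /prodvec big_split /= prodr_const card_ord exprVn big_split conjC_prod /=.
by ring.
Qed.

Lemma sic_prob_ge0 s : 0 <= sic_prob psi rho s.
Proof.
have [_ pos _] := rhoP.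
rewrite /sic_prob mulr_ge0 ?invr_ge0 ?exprn_ge0 //.
by have := pos (prodvec psi s); rewrite lecE => /andP[].
Qed.

Lemma density_sum_delta : \sum_x \sum_y rho x y * (x == y)%:R = 1.
Proof.
have [_ _ tr1] := rhoP; transitivity (trace rho) => //; apply: eq_bigr => x _.
by under eq_bigr do rewrite eq_sym; rewrite sum_delta_ffun.
Qed.

Lemma sum_sic_prob : \sum_s sic_prob psi rho s = 1.
Proof.
apply: complexI; rewrite rmorph_sum rmorph1 -density_sum_delta /=.
under eq_bigr do rewrite sic_probE.
rewrite exchange_big /=; apply: eq_bigr => x _.
rewrite exchange_big /=; apply: eq_bigr => y _.
rewrite -mulr_sumr -prod_eq_ffun -(bigA_distr_bigA (fun n j =>
  2^-1 * ((psi j (x n))^* * psi j (y n)))) /=; congr (_ * _).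
apply: eq_bigr => n _; rewrite -mulr_sumr.
by under eq_bigr do rewrite mulrC; rewrite SIC_povm // eq_sym; field.
Qed.

(* Fixing outcomes on S leaves the projector onto a product vector tensored with the identity, which is at most the identity. *)
Lemma sic_prob_marginal (S : {set 'I_N}) (t : {ffun {i : 'I_N | i \in S} -> 'I_4}) :
  \sum_(s | ffun_restr S s == t) sic_prob psi rho s <= 2^-1 ^+ #|S|.
Proof.
have [_ pos _] := rhoP.
rewrite -lecR rmorph_sum /=; under eq_bigr do rewrite sic_probE.
(* The kernel [q] is the observed projector on S and the identity elsewhere; [v] and [v'] are Gram
   vectors of [q] and of the identity minus [q], the latter being 0 off S. *)
pose q (n : 'I_N) (x y : 'I_2) : R[i] :=
  if insub n is Some i then (psi (t i) x)^* * psi (t i) y else (x == y)%:R.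
pose v (n : 'I_N) (a x : 'I_2) : R[i] :=
  if insub n is Some i then (psi (t i) a)^* * psi (t i) x else (a == x)%:R.
pose v' (n : 'I_N) (a x : 'I_2) : R[i] :=
  if insub n is Some i then (a == x)%:R - (psi (t i) a)^* * psi (t i) x else 0.
have -> : \sum_(s | ffun_restr S s == t) \sum_x \sum_y rho x y *
    \prod_n (2^-1 * ((psi (s n) (x n))^* * psi (s n) (y n))) =
    2^-1 ^+ #|S| * \sum_x \sum_y rho x y * \prod_n q n (x n) (y n).
  rewrite exchange_big mulr_sumr /=; apply: eq_bigr => x _.
  rewrite exchange_big mulr_sumr /=; apply: eq_bigr => y _.
  rewrite -mulr_sumr (sum_prod_ffun_restr t (fun n j =>
    2^-1 * ((psi j (x n))^* * psi j (y n)))) [RHS]mulrCA; congr (_ * _).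
  rewrite big_split /= prodr_const card_sub_ord -mulrA; congr (_ * _).
  rewrite -prod_insub; apply: eq_bigr => n _.
  rewrite /q; case: insubP => [i _ <- //|_].
  rewrite -mulr_sumr.
  by under eq_bigr do rewrite mulrC; rewrite SIC_povm // eq_sym; field.
rewrite rmorphXn fmorphV rmorph_nat -[leRHS]mulr1.
rewrite ler_wpM2l ?exprn_ge0 ?invr_ge0 // -[leRHS]density_sum_delta.
under [leRHS]eq_bigr do under eq_bigr do rewrite -prod_eq_ffun.
apply: (le_gram_prod (v := v) (v' := v')
  (q' := fun (_ : 'I_N) (x y : 'I_2) => (x == y)%:R)) => // n x y.
  rewrite /q /v; case: insubP => [i _ _|_]; first exact: projector_gram.
  by under eq_bigr do rewrite conjC_nat; rewrite sum_delta_ffun eq_sym.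
rewrite /q /v'; case: insubP => [i _ _|_].
  by rewrite -coprojector_gram //; ring.
by rewrite big1 ?addr0 // => a _; rewrite mulr0.
Qed.

(** Once the entries of rho are pulled out, the sum over outcomes factorizes into one-qubit
    inversions, even for entangled rho. *)
Lemma sum_sic_prob_shadow z w :
  \sum_s (sic_prob psi rho s)%:C%C * shadow psi s z w = rho z w.
Proof.
under eq_bigr do rewrite sic_probE mulr_suml.
rewrite exchange_big /=.
transitivity (\sum_x \sum_y rho x y * (y == w)%:R * (x == z)%:R).
  apply: eq_bigr => x _; under eq_bigr do rewrite mulr_suml.
  rewrite exchange_big /=; apply: eq_bigr => y _.
  under eq_bigr do rewrite -mulrA -big_split.
  rewrite -mulr_sumr /= -mulrA -2!prod_eq_ffun -big_split /=.
  rewrite -(bigA_distr_bigA (fun n j => 2^-1 * ((psi j (x n))^* * psi j (y n))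
    * shadow1 psi j (z n) (w n))) /=; congr (_ * _).
  apply: eq_bigr => n _; under eq_bigr do rewrite -mulrA.
  by rewrite -mulr_sumr shadow1_inversion // (eq_sym (x n)); field.
under eq_bigr do rewrite -mulr_suml sum_delta_ffun.
by rewrite sum_delta_ffun.
Qed.

End ManyQubits.

(** * Local observables: partial trace, norm bound and frame bound *)

(** Vectorization: row and column strings are merged into one string of pairs, so that an operator
    becomes a vector whose index still splits over sites. *)
Lemma sum_ffun_pair (V : nmodType) (I T : finType)
    (G : {ffun I -> T} -> {ffun I -> T} -> V) :
  \sum_a \sum_b G a b =
  \sum_(w : {ffun I -> T * T}) G [ffun i => (w i).1] [ffun i => (w i).2].
Proof.
rewrite pair_bigA /=.
rewrite (reindex (fun w : {ffun I -> T * T} =>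
  ([ffun i => (w i).1] : {ffun I -> T}, [ffun i => (w i).2] : {ffun I -> T}))) //=.
exists (fun p : {ffun I -> T} * {ffun I -> T} => [ffun i => (p.1 i, p.2 i)]).
  by move=> w _; apply/ffunP => i; rewrite !ffunE -surjective_pairing.
by move=> [a b] _; congr (_, _); apply/ffunP => i; rewrite !ffunE.
Qed.

Section Observables.
Variables (R : realType) (N : nat) (psi : 'I_4 -> 'I_2 -> R[i]).
Variables (S : {set 'I_N}) (O : op R (qubits S)).
Hypothesis psiP : SIC psi.
Hypothesis OP : is_hermitian O.

Definition local_shadow_trace (t : {ffun {i : 'I_N | i \in S} -> 'I_4}) : R[i] :=
  \sum_a \sum_b O a b * \prod_i shadow1 psi (t i) (b i) (a i).

(** Each site outside S carries the identity in the embedded observable and contributes its unit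
    trace. *)
Lemma trace_embed (f : 'I_N -> 'I_2 -> 'I_2 -> R[i]) :
  (forall n, \sum_a f n a a = 1) ->
  trace (opmul (embed O) (fun x y => \prod_n f n (x n) (y n))) =
  \sum_a \sum_b O a b * \prod_i f (val i) (b i) (a i).
Proof.
move=> f1; rewrite /trace /opmul.
rewrite (partition_big (ffun_restr S) xpredT) //=; apply: eq_bigr => a _.
rewrite (eq_bigr (fun x : qbasis N => \sum_b O a b *
    ((\prod_i f (val i) (b i) (x (val i))) * \prod_(n | n \notin S) f n (x n) (x n)))).
  rewrite exchange_big /=; apply: eq_bigr => b _; rewrite -mulr_sumr.
  congr (_ * _).
  rewrite (eq_bigr (fun x : qbasis N => \prod_n
    (if insub n is Some i then f n (b (i : {i : 'I_N | i \in S})) (x n) else f n (x n) (x n)))).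
    rewrite (sum_prod_ffun_restr a (fun n j =>
      if insub n is Some i then f n (b (i : {i : 'I_N | i \in S})) j else f n j j)).
    rewrite [X in _ * X]big1 ?mulr1; first by apply: eq_bigr => i _; rewrite valK.
    by move=> n nS; rewrite insubN.
  move=> x _; rewrite -(prod_insub (fun i => f (val i) (b i) (x (val i)))
    (fun n => f n (x n) (x n))).
  by apply: eq_bigr => n _; case: insubP => // i _ <-.
move=> x /eqP xa.
rewrite (partition_big (ffun_restr S) xpredT) //=; apply: eq_bigr => b _.
(* The conditional in [embed] is rewritten as a product of deltas over the sites off S, so that the
   sum over z factorizes. *)
rewrite (eq_bigr (fun z : qbasis N => O a b *
    \prod_n (((n \notin S) ==> (x n == z n))%:R * f n (z n) (x n)))).
  rewrite -mulr_sumr (sum_prod_ffun_restr b (fun n j =>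
    ((n \notin S) ==> (x n == j))%:R * f n j (x n))); congr (_ * (_ * _)).
    by apply: eq_bigr => i _; rewrite (valP i) mul1r.
  apply: eq_bigr => n nS; rewrite nS /=.
  by under eq_bigr do rewrite mulrC; under eq_bigr do rewrite eq_sym;
     rewrite (bigD1 (x n)) //= eqxx mulr1 big1 ?addr0 // => j /negPf ->; rewrite mulr0.
move=> z /eqP zb; rewrite big_split /= mulrA; congr (_ * _).
rewrite /embed -[restr S x]/(ffun_restr S x) -[restr S z]/(ffun_restr S z) xa zb.
case: (boolP [forall i, _]) => [/forallP h|/forallPn[i /negPf h]].
  by rewrite big1 ?mulr1 // => n _; rewrite h.
by rewrite (bigD1 i) //= h mul0r mulr0.
Qed.

Lemma trace_embed_shadow s :
  trace (opmul (embed O) (shadow psi s)) = local_shadow_trace (ffun_restr S s).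
Proof.
rewrite (trace_embed (f := fun n => shadow1 psi (s n))); last first.
  by move=> n; exact: shadow1_trace.
by apply: eq_bigr => a _; apply: eq_bigr => b _; congr (_ * _); apply: eq_bigr => i _;
   rewrite ffunE.
Qed.

Lemma hermitian_conj a b : (O a b)^* = O b a.
Proof. exact: esym (OP a b). Qed.

Lemma local_shadow_trace_real t : local_shadow_trace t \is Num.real.
Proof.
apply/CrealP; rewrite /local_shadow_trace conjC_sum exchange_big /=.
apply: eq_bigr => a _; rewrite conjC_sum; apply: eq_bigr => b _.
rewrite conjCM hermitian_conj conjC_prod; congr (_ * _).
by apply: eq_bigr => i _; rewrite conj_shadow1.
Qed.

Let Opair (w : {ffun {i : 'I_N | i \in S} -> 'I_2 * 'I_2}) : R[i] :=
  O [ffun i => (w i).1] [ffun i => (w i).2].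

Let local_shadow_traceE t : local_shadow_trace t =
  \sum_w Opair w * \prod_i shadow1 psi (t i) (w i).2 (w i).1.
Proof.
rewrite /local_shadow_trace sum_ffun_pair; apply: eq_bigr => w _; congr (_ * _).
by apply: eq_bigr => i _; rewrite !ffunE.
Qed.

Lemma trsqE : (trsq O)%:C%C = \sum_a \sum_b O a b * (O a b)^*.
Proof.
rewrite /trsq RRe_real /trace /opmul.
  by apply: eq_bigr => a _; apply: eq_bigr => b _; rewrite hermitian_conj.
apply: ger0_real; apply: sumr_ge0 => a _; apply: sumr_ge0 => b _.
by rewrite -(hermitian_conj a) mul_conjC_ge0.
Qed.

Let trsq_pair : (trsq O)%:C%C = \sum_w Opair w * (Opair w)^*.
Proof. by rewrite trsqE sum_ffun_pair. Qed.

(** Cauchy-Schwarz for the Hilbert-Schmidt product, the local shadow having squared norm 5 per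
    qubit. *)
Lemma local_shadow_trace_le t :
  local_shadow_trace t * (local_shadow_trace t)^* <= 5 ^+ #|S| * (trsq O)%:C%C.
Proof.
rewrite local_shadow_traceE trsq_pair.
apply: cauchy_schwarz_sum; first by rewrite exprn_gt0.
rewrite -card_sub_ord -prodr_const.
rewrite (eq_bigr (fun w : {ffun {i : 'I_N | i \in S} -> 'I_2 * 'I_2} =>
  \prod_i (shadow1 psi (t i) (w i).2 (w i).1 *
    (shadow1 psi (t i) (w i).2 (w i).1)^*))); last first.
  by move=> w _; rewrite conjC_prod big_split.
rewrite -(bigA_distr_bigA (fun i (p : 'I_2 * 'I_2) =>
  shadow1 psi (t i) p.2 p.1 * (shadow1 psi (t i) p.2 p.1)^*)) /=.
apply: eq_bigr => i _.
rewrite -(pair_bigA _ (fun a b => shadow1 psi (t i) b a * (shadow1 psi (t i) b a)^*)) /=.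
by rewrite exchange_big shadow1_norm.
Qed.

(* The one-qubit frame operator is 6 on traceless operators and 2 on the identity, hence at most 6. *)
Lemma sum_local_shadow_trace_le :
  \sum_t local_shadow_trace t * (local_shadow_trace t)^* <=
  6 ^+ #|S| * (trsq O)%:C%C.
Proof.
pose B (x y : {ffun {i : 'I_N | i \in S} -> 'I_2 * 'I_2}) := (Opair x)^* * Opair y.
have hB : positive_kernel B.
  move=> v; rewrite (_ : \sum_x _ =
      (\sum_y Opair y * v y) * (\sum_y Opair y * v y)^*); first exact: mul_conjC_ge0.
  rewrite conjC_sum mulr_sumr; apply: eq_bigr => x _.
  rewrite mulr_suml; apply: eq_bigr => y _.
  by rewrite /B conjCM; ring.
pose q (_ : {i : 'I_N | i \in S}) (x y : 'I_2 * 'I_2) : R[i] :=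
  \sum_j (shadow1 psi j x.2 x.1)^* * shadow1 psi j y.2 y.1.
pose q' (_ : {i : 'I_N | i \in S}) (x y : 'I_2 * 'I_2) : R[i] := 6 * (x == y)%:R.
pose v (_ : {i : 'I_N | i \in S}) (j : 'I_4) (x : 'I_2 * 'I_2) := shadow1 psi j x.2 x.1.
(* The gap between 6 and the frame operator is twice the rank-one kernel of the vectorized identity:
   two of the four Gram vectors are that vector, the others are 0. *)
pose v' (_ : {i : 'I_N | i \in S}) (j : 'I_4) (x : 'I_2 * 'I_2) : R[i] :=
  (j < 2)%N%:R * (x.1 == x.2)%:R.
have := le_gram_prod (q := q) (q' := q') (v := v) (v' := v') hB.
rewrite [X in _ -> _ -> X <= _](_ : _ =
  \sum_t local_shadow_trace t * (local_shadow_trace t)^*).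
  rewrite [X in _ -> _ -> _ <= X](_ : _ = 6 ^+ #|S| * (trsq O)%:C%C).
    apply=> // i [x1 x2] [y1 y2]; rewrite /q /q' /v' /=.
    under eq_bigr do rewrite conj_shadow1.
    rewrite shadow1_frame // xpair_eqE -mulnb natrM !big_ord_recl big_ord0 /=.
    rewrite !conjCM !conjC_nat (eq_sym y2 x2) (eq_sym y2 y1); ring.
  rewrite trsq_pair mulr_sumr; apply: eq_bigr => x _.
  rewrite (eq_bigr (fun y => 6 ^+ #|S| * B x y * (y == x)%:R)).
    by rewrite sum_delta_ffun /B; ring.
  move=> y _; rewrite /q' big_split /= prodr_const card_sub_ord prod_eq_ffun eq_sym; ring.
under [RHS]eq_bigr do rewrite local_shadow_traceE mulrC conjC_sum mulr_suml.
rewrite [RHS]exchange_big; apply: eq_bigr => x _ /=.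
under [RHS]eq_bigr do rewrite mulr_sumr.
rewrite [RHS]exchange_big; apply: eq_bigr => y _ /=.
rewrite bigA_distr_bigA mulr_sumr; apply: eq_bigr => t _.
by rewrite /B conjCM conjC_prod big_split /=; ring.
Qed.

End Observables.

(** * The real-valued estimator and its moments *)

Section RealEstimator.
Variables (R : realType) (N : nat) (psi : 'I_4 -> 'I_2 -> R[i]).
Variables (rho : op R (qbasis N)) (S : {set 'I_N}) (O : op R (qubits S)).
Hypothesis psiP : SIC psi.
Hypothesis rhoP : density rho.
Hypothesis OP : is_hermitian O.

(** Taken real to fit the concentration bound; [estimatorE] shows that the real part loses
    nothing. *)
Definition estimator (s : {ffun 'I_N -> 'I_4}) : R :=
  complex.Re (trace (opmul (embed O) (shadow psi s))).

Lemma estimatorE s :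
  (estimator s)%:C%C = trace (opmul (embed O) (shadow psi s)).
Proof. by rewrite /estimator RRe_real // trace_embed_shadow // local_shadow_trace_real. Qed.

Lemma estimator_sqr s :
  (estimator s ^+ 2)%:C%C = local_shadow_trace psi O (ffun_restr S s) *
    (local_shadow_trace psi O (ffun_restr S s))^*.
Proof.
rewrite -trace_embed_shadow // -estimatorE rmorphXn /= conj_Creal ?expr2 //.
by rewrite complex_real.
Qed.

Lemma estimator_sqr_le s : estimator s ^+ 2 <= 5 ^+ #|S| * trsq O.
Proof.
rewrite -lecR estimator_sqr rmorphM rmorphXn rmorph_nat.
exact: local_shadow_trace_le.
Qed.

Lemma estimator_norm_le s :
  (5%:R / 9%:R) ^+ #|S| <= trsq O -> `|estimator s| <= 3 ^+ #|S| * trsq O.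
Proof.
move=> hT; have T0 : 0 <= trsq O.
  by apply: le_trans hT; rewrite exprn_ge0 // divr_ge0.
have v0 : 0 <= 3 ^+ #|S| * trsq O by rewrite mulr_ge0 // exprn_ge0.
rewrite -(ger0_norm v0) -ler_sqr ?nnegrE ?normr_ge0 //.
rewrite !real_normK ?num_real //.
apply: le_trans (estimator_sqr_le s) _.
(* With T = tr(O^2), the squared claim follows from 5^|S| T <= 9^|S| T^2; cancelling one T leaves
   the assumed lower bound on T. *)
rewrite exprMn exprAC [trsq O ^+ 2]expr2 mulrA ler_wpM2r //.
have -> : (3 ^+ 2 : R) = 9 by ring.
rewrite mulrC -ler_pdivrMr ?exprn_gt0 //.
by rewrite -expr_div_n.
Qed.

(** The estimator sees only the outcomes on S; grouping by them, the marginal bound 2^-|S| and the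
    frame bound 6^|S| multiply to 3^|S|. *)
Lemma estimator_second_moment :
  \sum_s sic_prob psi rho s * estimator s ^+ 2 <= 3 ^+ #|S| * trsq O.
Proof.
pose Y2 t := complex.Re (local_shadow_trace psi O t * (local_shadow_trace psi O t)^*).
have Y2E t : (Y2 t)%:C%C = local_shadow_trace psi O t * (local_shadow_trace psi O t)^*.
  by rewrite RRe_real // ger0_real // mul_conjC_ge0.
have Y20 t : 0 <= Y2 t by rewrite -lecR Y2E mul_conjC_ge0.
have estE s : estimator s ^+ 2 = Y2 (ffun_restr S s).
  by apply: complexI; rewrite Y2E -estimator_sqr.
rewrite (partition_big (ffun_restr S) xpredT) //=.
apply: (@le_trans _ _ (\sum_t 2^-1 ^+ #|S| * Y2 t)).
  apply: ler_sum => t _.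
  rewrite (eq_bigr (fun s => sic_prob psi rho s * Y2 t)); last first.
    by move=> s /eqP <-; rewrite estE.
  by rewrite -mulr_suml ler_wpM2r // sic_prob_marginal.
rewrite -mulr_sumr exprVn mulrC ler_pdivrMr ?exprn_gt0 //.
rewrite mulrAC -exprMn -natrM -lecR rmorph_sum rmorphM rmorphXn rmorph_nat /=.
under eq_bigr do rewrite Y2E.
exact: sum_local_shadow_trace_le.
Qed.

Lemma estimator_mean :
  (\sum_s sic_prob psi rho s * estimator s)%:C%C = trace (opmul (embed O) rho).
Proof.
rewrite rmorph_sum /=.
under eq_bigr do rewrite rmorphM /= estimatorE /trace mulr_sumr.
rewrite exchange_big /=; apply: eq_bigr => x _.
under eq_bigr do rewrite /opmul mulr_sumr.
rewrite exchange_big /=; apply: eq_bigr => z _.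
rewrite -(sum_sic_prob_shadow psiP rhoP) mulr_sumr; apply: eq_bigr => s _.
by rewrite mulrCA.
Qed.

End RealEstimator.

(** * Reduction of the theorem to uniform concentration *)

Local Open Scope complex_scope.

Theorem mainTheorem2 (R : realType) (N : nat) (psi : 'I_4 -> 'I_2 -> R[i])
  (rho : op R (qbasis N)) (L K : nat)
  (Ks : 'I_L -> {set 'I_N}) (Oloc : forall l : 'I_L, op R (qubits (Ks l)))
  (eps delta : R) (M : nat) :
  SIC psi ->
  density rho ->
  (0 < L)%N ->
  (forall l, is_hermitian (Oloc l)) ->
  (forall l, (#|Ks l| <= K)%N) ->
  (forall l, (5%:R / 9%:R) ^+ #|Ks l| <= trsq (Oloc l)) ->
  0 < eps < 1 -> 0 < delta < 1 ->
  8%:R / 3%:R * 3%:R ^+ K * (\big[Num.max/0]_(l < L) trsq (Oloc l))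
    * ln (2%:R * L%:R / delta) / eps ^+ 2 <= M%:R ->
  1 - delta <=
    prob_shadows psi rho
      (fun w => [forall l : 'I_L,
         `| (M%:R)^-1%:C * \sum_(m < M) trace (opmul (embed (Oloc l)) (shadow psi (w m)))
            - trace (opmul (embed (Oloc l)) rho) | <= eps%:C]).
Proof.
move=> psiP rhoP L0 OP KsK hT he hd hM.
pose v := 3 ^+ K * \big[Num.max/0]_(l < L) trsq (Oloc l).
have T0 l : 0 < trsq (Oloc l).
  by apply: lt_le_trans (hT l); rewrite exprn_gt0 // divr_gt0.
have vl l : 3 ^+ #|Ks l| * trsq (Oloc l) <= v.
  apply: ler_pM; rewrite ?exprn_ge0 ?(ltW (T0 l)) //.
    by rewrite ler_weXn2l // ler1n.
  exact: (le_bigmax _ (fun l => trsq (Oloc l))).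
(* Since L > 0 there is an observable, and its positive trace bounds v from below. *)
have v0 : 0 < v.
  by apply: lt_le_trans (vl (Ordinal L0)); rewrite mulr_gt0 ?exprn_gt0.
rewrite [X in X * ln _](_ : _ = 8 / 3 * v) in hM; last by rewrite /v mulrA.
(* Every trace in the event is real, so the complex modulus becomes a real absolute value and the
   event that of the concentration lemma. *)
have -> : prob_shadows psi rho (fun w => [forall l : 'I_L,
     `| (M%:R)^-1%:C * \sum_(m < M) trace (opmul (embed (Oloc l)) (shadow psi (w m)))
            - trace (opmul (embed (Oloc l)) rho) | <= eps%:C]) =
   \sum_(w : {ffun 'I_M -> {ffun 'I_N -> 'I_4}} | [forall l : 'I_L,
     `|M%:R^-1 * \sum_(m < M) estimator psi (Oloc l) (w m)
       - \sum_s sic_prob psi rho s * estimator psi (Oloc l) s| <= eps])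
     \prod_(m < M) sic_prob psi rho (w m).
  apply: eq_bigl => w; apply: eq_forallb => l.
  rewrite -(estimator_mean psiP rhoP (OP l)).
  under eq_bigr do rewrite -(estimatorE psiP (OP l)).
  rewrite -rmorph_sum -rmorphM -rmorphB /=.
  by rewrite normc_def /= expr0n addr0 sqrtr_sqr lecR.
apply: (uniform_concentration _ _ L0 v0 he hd _ _ hM).
- exact: sic_prob_ge0.
- exact: sum_sic_prob.
- by move=> l s; apply: le_trans (vl l); exact: estimator_norm_le.
- by move=> l; apply: le_trans (vl l); exact: estimator_second_moment.
Qed.
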